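(* Let $A\in\mathbb{X}^{m\times n}$ be a column regular matrix and $\mathbf{d}\in\mathbb{X}^m$ a nonzero vector such that $A$ is consistent with $\mathbf{d}$. Then the inequality $A\mathbf{x}\le\mathbf{d}$ has solutions, and its solutions $\mathbf{x}\in\mathbb{X}^n$ are exactly the vectors satisfying $$\mathbf{x}\le(\mathbf{d}^-A)^-.$$
   Context: $\langle\mathbb{X},\mathbf{0},\mathbf{1},\oplus,\otimes\rangle$ is a linearly ordered radicable idempotent semifield: a commutative semiring with zero $\mathbf{0}$ and identity $\mathbf{1}\neq\mathbf{0}$ in which $x\oplus x=x$ for all $x$, every nonzero $x$ has a multiplicative inverse $x^{-1}$, the power $x^q$ is defined for every nonzero $x$ and rational $q$ (every nonzero element has roots of all orders), and the relation $x\le y\iff x\oplus y=y$ is a total order. The sign $\otimes$ is omitted. Vector and matrix operations over $\mathbb{X}$ follow the usual rules with $\oplus,\otimes$ in place of $+,\times$; vector inequalities are component-wise. For a column (row) vector $\mathbf{x}=(x_i)$, $\mathbf{x}^-$ is the row (column) vector with components $x_i^-=x_i^{-1}$ if $x_i\neq\mathbf{0}$ and $x_i^-=\mathbf{0}$ otherwise. A matrix is column regular if it has no zero columns. Consistency: let $I=\{i: d_i=\mathbf{0}\}$ and $J=\{j: a_{ij}>\mathbf{0}\text{ for some } i\in I\}$. $A=(a_{ij})$ is consistent with $\mathbf{d}$ if $a_{ij}=\mathbf{0}$ whenever $i\notin I$ and $j\in J$. *)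

(* Defs.v *)
From HB Require Import structures.
From mathcomp Require Import all_boot all_order all_algebra.

Set Implicit Arguments.
Unset Strict Implicit.
Unset Printing Implicit Defensive.

Import Order.TTheory GRing.Theory.
Local Open Scope ring_scope.

(* Only the values of [sinv] at nonzero elements are constrained.
   [add_total] is totality of the order [x <= y] iff [x + y = y]. Roots of nonzero
   elements are unique because the order is total, so [radicable] is what makes
   rational powers well defined. *)
HB.mixin Record isIdempotentSemifield X of GRing.ComNzSemiRing X := {
  addii : forall x : X, x + x = x;
  add_total : forall x y : X, x + y = y \/ y + x = x;
  sinv : X -> X;
  mulVs : forall x : X, x != 0 -> sinv x * x = 1;
  radicable : forall (x : X) (k : nat),
    x != 0 -> (0 < k)%N -> exists y : X, y ^+ k = x
}.

#[short(type="idempotentSemifieldType")]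
HB.structure Definition IdempotentSemifield :=
  { X of isIdempotentSemifield X & GRing.ComNzSemiRing X }.

Section Order.
Variable X : idempotentSemifieldType.

Definition sle (x y : X) : bool := x + y == y.

Fact sle_refl : reflexive sle.
Proof. by move=> x; rewrite /sle addii. Qed.

Fact sle_anti : antisymmetric sle.
Proof. by move=> x y /andP[/eqP <- /eqP]; rewrite addrAC addii addrC. Qed.

Fact sle_trans : transitive sle.
Proof. by move=> y x z /eqP xy /eqP yz; rewrite /sle -yz addrA xy. Qed.

Fact sle_total : total sle.
Proof.
by move=> x y; rewrite /sle; case: (add_total x y) => ->; rewrite eqxx ?orbT.
Qed.

End Order.

(* A structure joining semirings and orders cannot be declared after the numeric
   hierarchy, so the order is attached to the carrier; taking it at
   [ring_display] makes [<=] and [<] available in [ring_scope]. *)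
HB.instance Definition _ (X : idempotentSemifieldType) :=
  Order.Le_isPOrder.Build ring_display (IdempotentSemifield.sort X)
    (@sle_refl X) (@sle_anti X) (@sle_trans X).
HB.instance Definition _ (X : idempotentSemifieldType) :=
  Order.POrder_isTotal.Build ring_display (IdempotentSemifield.sort X)
    (@sle_total X).

Section Definitions.
Variable X : idempotentSemifieldType.

(* Multiplicative conjugate transpose; it sends a column vector to a row vector
   and conversely. *)
Definition mulconjmx (m n : nat) (A : 'M[X]_(m, n)) : 'M[X]_(n, m) :=
  \matrix_(j, i) (if A i j == 0 then 0 else sinv (A i j)).

Definition lemx (m n : nat) (A B : 'M[X]_(m, n)) : Prop :=
  forall i j, A i j <= B i j.

Definition column_regular (m n : nat) (A : 'M[X]_(m, n)) : Prop :=
  forall j, col j A != 0.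

Definition zero_rows (m : nat) (d : 'cV[X]_m) : {set 'I_m} :=
  [set i | d i 0 == 0].

Definition forced_columns (m n : nat) (A : 'M[X]_(m, n)) (d : 'cV[X]_m) :
    {set 'I_n} :=
  [set j | [exists i in zero_rows d, (0 : X) < A i j]].

Definition consistent (m n : nat) (A : 'M[X]_(m, n)) (d : 'cV[X]_m) : Prop :=
  forall i j, i \notin zero_rows d -> j \in forced_columns A d -> A i j = 0.

End Definitions.

(* Main.v *)
Require Import Defs.
From mathcomp Require Import all_boot all_order all_algebra.
Import Order.TTheory GRing.Theory.
Local Open Scope ring_scope.

(** The unknowns decouple: [A x <= d] says [a_ij x_j <= d_i] for all [i], [j]. Let
    [s_j] be the [j]-th entry of [d^- A]. If [s_j] is nonzero, then consistency
    kills the entries of column [j] in the rows where [d] vanishes, and the other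
    rows say [s_j x_j <= 1]. If [s_j = 0], then column [j] lives in the rows where
    [d] vanishes; being nonzero, it forces [x_j = 0]. *)

Section SemifieldOrder.
Variable X : idempotentSemifieldType.
Implicit Types x y z c : X.

Lemma sleE x y : (x <= y) = (x + y == y).
Proof. by []. Qed.

Lemma sle0x x : (0 : X) <= x.
Proof. by rewrite sleE add0r. Qed.

Lemma slex0 x : (x <= 0) = (x == 0).
Proof. by rewrite sleE addr0. Qed.

Lemma slt0x x : ((0 : X) < x) = (x != 0).
Proof. by rewrite lt_neqAle sle0x andbT eq_sym. Qed.

Lemma sleDx x y z : (x + y <= z) = (x <= z) && (y <= z).
Proof.
apply/idP/andP => [xyz | [/eqP xz /eqP yz]]; last by rewrite sleE -addrA yz xz.
split; apply: le_trans xyz; rewrite sleE; first by rewrite addrA addii.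
by rewrite addrCA addii.
Qed.

(** By [sleDx] addition is the join of the order, and 0 is its bottom, so a finite sum, even an
    empty one, is the supremum of its terms. *)
Lemma sle_sumP (I : finType) (F : I -> X) z :
  reflect (forall i, F i <= z) (\sum_i F i <= z).
Proof.
rewrite (big_morph (fun x => x <= z) (fun x y => sleDx x y z) (sle0x z)).
by rewrite big_andE; apply: forallP.
Qed.

Lemma sle_mul2l c x y : x <= y -> c * x <= c * y.
Proof. by move/eqP=> xy; rewrite sleE -mulrDr xy. Qed.

Lemma mulsV c : c != 0 -> c * sinv c = 1.
Proof. by move=> c0; rewrite mulrC mulVs. Qed.

(** Multiplying by [c] and by [sinv c] are mutually inverse monotone maps. *)
Lemma sle_pdivrMl c x y : c != 0 -> (sinv c * x <= y) = (x <= c * y).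
Proof.
move=> c0; apply/idP/idP => /sle_mul2l.
  by move/(_ c); rewrite mulrA mulsV // mul1r.
by move/(_ (sinv c)); rewrite mulrA mulVs // mul1r.
Qed.

Lemma sle_pdivlMl c x y : c != 0 -> (x <= sinv c * y) = (c * x <= y).
Proof.
move=> c0; apply/idP/idP => /sle_mul2l.
  by move/(_ c); rewrite mulrA mulsV // mul1r.
by move/(_ (sinv c)); rewrite mulrA mulVs // mul1r.
Qed.

End SemifieldOrder.

Lemma lemx_mul_colP (X : idempotentSemifieldType) (m n : nat)
    (A : 'M[X]_(m, n)) (x : 'cV[X]_n) (d : 'cV[X]_m) :
  lemx (A *m x) d <-> forall j i, A i j * x j 0 <= d i 0.
Proof.
split=> [le_d j i | le_d i k]; last first.
  by rewrite ord1 mxE; apply/sle_sumP => j; apply: le_d.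
by have := le_d i 0; rewrite mxE => /sle_sumP.
Qed.

Theorem lemma7 (X : idempotentSemifieldType) (m n : nat)
    (A : 'M[X]_(m, n)) (d : 'cV[X]_m) :
  column_regular A -> d != 0 -> consistent A d ->
  (exists x : 'cV[X]_n, lemx (A *m x) d) /\
  (forall x : 'cV[X]_n,
     lemx (A *m x) d <-> lemx x (mulconjmx (mulconjmx d *m A))).
Proof.
move=> regA _ consA; split.
  by exists 0 => i j; rewrite mulmx0 mxE sle0x.
move=> x; have [le_entries entries_le] := lemx_mul_colP X m n A x d.
set s := mulconjmx d *m A.
have sE j : s 0 j = \sum_i mulconjmx d 0 i * A i j by rewrite mxE.
suff col_j j : (forall i, A i j * x j 0 <= d i 0) <-> x j 0 <= mulconjmx s j 0.
  split=> [/le_entries le_d j k | le_s]; first by rewrite ord1; apply/col_j.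
  by apply: entries_le => j; apply/col_j.
rewrite [mulconjmx s j 0]mxE; have [s0 | s_neq0] := eqVneq (s 0 j) 0.
(* The conjugate of a zero entry is 0, so the bound on [x j 0] is 0 here. A sum equal to 0 has only
   zero terms, and the factor [sinv (d i 0)] cancels. *)
- have A0 i : d i 0 != 0 -> A i j = 0.
    move=> di; have : s 0 j <= 0 by rewrite s0.
    rewrite sE => /sle_sumP/(_ i); rewrite mxE (negPf di) sle_pdivrMl //.
    by rewrite mulr0 slex0 => /eqP.
  split=> [le_d | x0 i]; last first.
    by move: x0; rewrite slex0 => /eqP ->; rewrite mulr0 sle0x.
  have [i Aij] : exists i, A i j != 0.
    apply/existsP; apply: contraNT (regA j) => /existsPn A_j0.
    by apply/eqP/colP => i; rewrite !mxE; apply/eqP/negPn.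
  have di : d i 0 = 0 by apply/eqP; apply: contraNT Aij => /A0 ->.
  (* Writing the bound 0 as [A i j * 0] lets the nonzero factor [A i j] be divided out. *)
  by have := le_d i; rewrite di -[X in _ <= X](mulr0 (A i j)) -sle_pdivrMl //
    mulrA mulVs // mul1r.
(* Otherwise [j] is a forced column and [s 0 j] vanishes: its terms are 0 by the convention for
   conjugates where [d] is zero, and by consistency elsewhere. *)
- have A0 i : d i 0 = 0 -> A i j = 0.
    move=> di; apply/eqP; apply: contraNT s_neq0 => Aij.
    rewrite sE big1 // => k _; rewrite mxE.
    case: eqVneq => [_ | dk]; first by rewrite mul0r.
    rewrite consA ?mulr0 // !inE //.
    by apply/existsP; exists i; rewrite inE di eqxx slt0x.
  rewrite -[sinv _]mulr1 sle_pdivlMl // sE mulr_suml.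
  (* Where [d i 0 = 0], both inequalities hold trivially, since [A0] makes both left-hand sides
     0. *)
  have row_i i : (mulconjmx d 0 i * A i j * x j 0 <= 1) = (A i j * x j 0 <= d i 0).
    rewrite mxE; case: eqVneq => [di | di].
      by rewrite A0 // !mul0r !sle0x.
    by rewrite -mulrA sle_pdivrMl // mulr1.
  split=> [le_d | /sle_sumP le_1 i]; last by rewrite -row_i.
  by apply/sle_sumP => i; rewrite row_i.
Qed.
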